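(* For $x\in[-\pi/2,\pi/2]$, we have (i) $$(\alpha-1)\frac{x}{\sin x}+\frac{x}{\tan x}\le \alpha,$$ (ii) $$\left(\frac{x}{\sin x}\right)^{\alpha}+\frac{x}{\tan x}<\left(\frac{\pi}{2}\right)^{\alpha}\quad\text{(strict for } x\in(-\pi/2,\pi/2)\text{, with equality at } x=\pm\pi/2\text{)},$$ with the best possible constant $\alpha=\pi/(\pi-2)$ (in both (i) and (ii)). Inequality (i) is sharp (equality holds) for $x\in\{-\pi/2,0,\pi/2\}$, and inequality (ii) is sharp (equality holds) for $x\in\{-\pi/2,\pi/2\}$.
   Context: The functions are understood as extended by their limits: $\frac{x}{\sin x}=1$ and $\frac{x}{\tan x}=1$ at $x=0$, and $\frac{x}{\tan x}=\frac{x\cos x}{\sin x}=0$ at $x=\pm\pi/2$.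
   Formalization: In (ii) ''best possible'' fails if α is varied in both exponents at once (the inequality also holds for exponents 2 and 3); it is proved instead that α is the largest exponent on the left with (π/2)^α fixed, and the smallest exponent on the right with the left one fixed. *)

(* Defs.v *)
From Stdlib Require Import Reals.
Open Scope R_scope.

(* The functions x / sin x and x / tan x on [-PI/2, PI/2], extended by their
   limits.  The values at +-PI/2 must be given explicitly because there
   [tan x] is [sin x * / 0]. *)
Definition x_over_sin (x : R) : R :=
  if Req_EM_T x 0 then 1 else x / sin x.

Definition x_over_tan (x : R) : R :=
  if Req_EM_T x 0 then 1
  else if Req_EM_T x (PI / 2) then 0
  else if Req_EM_T x (- (PI / 2)) then 0
  else x / tan x.

Definition alpha : R := PI / (PI - 2).

(* Main.v *)
(** Write [K = alpha - 1 = 2 / (PI - 2)].  On [(0, PI/2)], inequality (i) says that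
    [f x = (sin x - x cos x) - K (x - sin x)] is positive.  Now [f] vanishes at [0]
    and [PI/2], and [f' x = (1 - cos x) (p x - K)] with [p x = x sin x / (1 - cos x)]
    strictly decreasing, so by the mean value theorem on both sides of [x],
    [f x <= 0] would give [p a <= K <= p b] for some [a < x < b].
    For (ii), put [u = x / sin x].  By (i) the left-hand side is at most
    [u^alpha + alpha - K u], which is strictly increasing for [u >= 1] and equals
    [(PI/2)^alpha] at [u = PI/2].  All constants are optimal because of [x = PI/2]. *)
Require Import Defs.
From Stdlib Require Import Reals Lra.
From Coquelicot Require Import Coquelicot.
Open Scope R_scope.

Lemma PI_gt_2 : 2 < PI.
Proof. generalize PI2_1; lra. Qed.

Lemma alpha_sub_1_pos : 0 < alpha - 1.
Proof.
  unfold alpha; pose proof PI_gt_2.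
  replace (PI / (PI - 2) - 1) with (2 / (PI - 2)) by (field; lra).
  apply Rdiv_lt_0_compat; lra.
Qed.

(** This is equality in (i) at [PI / 2], where the tangent term vanishes; it is the equation that
    determines [alpha]. *)
Lemma alpha_at_PI2 : (alpha - 1) * (PI / 2) = alpha.
Proof. unfold alpha; pose proof PI_gt_2; field; lra. Qed.

Lemma cos_lt_1 (x : R) : 0 < x < PI -> cos x < 1.
Proof. intros Hx; rewrite <- cos_0; apply cos_decreasing_1; lra. Qed.

(** Since [sin x ^ 2 = (1 - cos x) * (1 + cos x)], one factor [1 - cos x] cancels in the derivative,
    leaving [(sin x - x) / (1 - cos x)], which is negative because [sin x < x]. *)
Lemma x_sin_over_1_sub_cos_decr (a b : R) : 0 < a -> a < b -> b < PI ->
  b * sin b / (1 - cos b) < a * sin a / (1 - cos a).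
Proof.
  intros Ha Hab Hb.
  destruct (MVT_cor2 (fun x => x * sin x / (1 - cos x))
              (fun x => (sin x - x) / (1 - cos x)) a b Hab) as [c [Hc Hacb]].
  - intros x Hx; apply is_derive_Reals.
    pose proof (cos_lt_1 x ltac:(lra)) as Hcos.
    auto_derive; [lra|].
    pose proof (sin2_cos2 x) as H2; unfold Rsqr in H2.
    field_simplify_eq; [|lra].
    replace (sin x ^ 2) with (1 - cos x ^ 2) by lra; ring.
  - pose proof (cos_lt_1 c ltac:(lra)); pose proof (sin_lt_x c ltac:(lra)).
    assert (0 < (c - sin c) / (1 - cos c)) by (apply Rdiv_lt_0_compat; lra).
    replace ((sin c - c) / (1 - cos c)) with (- ((c - sin c) / (1 - cos c))) in Hc
      by (field; lra).
    simpl in Hc; nra.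
Qed.

(** Strict (i) cleared of its denominator [sin x], with the terms regrouped so that both sides
    vanish at [0]. *)
Lemma ineq_i_polynomial_form (x : R) : 0 < x < PI / 2 ->
  (alpha - 1) * (x - sin x) < sin x - x * cos x.
Proof.
  intros Hx.
  set (f := fun t => sin t - t * cos t - (alpha - 1) * (t - sin t)).
  set (f' := fun t => t * sin t - (alpha - 1) * (1 - cos t)).
  assert (Hd : forall t, derivable_pt_lim f t (f' t)).
  { intros t; apply is_derive_Reals; unfold f, f'; auto_derive; [easy | ring]. }
  assert (f0 : f 0 = 0) by (unfold f; rewrite sin_0; ring).
  assert (f1 : f (PI / 2) = 0).
  { unfold f; rewrite sin_PI2, cos_PI2; generalize alpha_at_PI2; lra. }
  destruct (Rlt_le_dec 0 (f x)) as [Hf | Hf]; [unfold f in Hf; lra | exfalso].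
  destruct (MVT_cor2 f f' 0 x) as [a [Ea Ha]]; [lra | auto |].
  destruct (MVT_cor2 f f' x (PI / 2)) as [b [Eb Hb]]; [lra | auto |].
  (* As [f] vanishes at both ends and [f x <= 0], its mean slope is nonpositive on [[0, x]] and
     nonnegative on [[x, PI / 2]]. *)
  assert (Fa : f' a <= 0) by nra.
  assert (Fb : 0 <= f' b) by nra.
  unfold f' in Fa, Fb.
  pose proof (cos_lt_1 a ltac:(lra)); pose proof (cos_lt_1 b ltac:(lra)).
  pose proof (x_sin_over_1_sub_cos_decr a b ltac:(lra) ltac:(lra) ltac:(lra)) as Hp.
  assert (a * sin a / (1 - cos a) <= alpha - 1) by (apply Rle_div_l; lra).
  assert (alpha - 1 <= b * sin b / (1 - cos b)) by (apply Rle_div_r; lra).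
  lra.
Qed.

Lemma x_over_sin_even (x : R) : x_over_sin (- x) = x_over_sin x.
Proof.
  unfold x_over_sin.
  destruct (Req_EM_T (- x) 0), (Req_EM_T x 0); try lra.
  now rewrite sin_neg, Rdiv_opp_l, Rdiv_opp_r, Ropp_involutive.
Qed.

Lemma x_over_tan_even (x : R) : x_over_tan (- x) = x_over_tan x.
Proof.
  unfold x_over_tan.
  destruct (Req_EM_T (- x) 0), (Req_EM_T x 0); try lra.
  destruct (Req_EM_T (- x) (PI / 2)), (Req_EM_T (- x) (- (PI / 2))),
    (Req_EM_T x (PI / 2)), (Req_EM_T x (- (PI / 2))); try lra.
  now rewrite tan_neg, Rdiv_opp_l, Rdiv_opp_r, Ropp_involutive.
Qed.

Lemma x_over_sin_0 : x_over_sin 0 = 1.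
Proof. unfold x_over_sin; destruct (Req_EM_T 0 0); lra. Qed.

Lemma x_over_tan_0 : x_over_tan 0 = 1.
Proof. unfold x_over_tan; destruct (Req_EM_T 0 0); lra. Qed.

Lemma x_over_sin_PI2 : x_over_sin (PI / 2) = PI / 2.
Proof.
  pose proof PI_gt_2; unfold x_over_sin; rewrite sin_PI2.
  destruct (Req_EM_T (PI / 2) 0); lra.
Qed.

Lemma x_over_tan_PI2 : x_over_tan (PI / 2) = 0.
Proof.
  pose proof PI_gt_2; unfold x_over_tan.
  destruct (Req_EM_T (PI / 2) 0), (Req_EM_T (PI / 2) (PI / 2)); lra.
Qed.

Lemma x_over_sin_gt_1 (x : R) : 0 < x < PI / 2 -> 1 < x_over_sin x.
Proof.
  intros Hx; unfold x_over_sin; destruct (Req_EM_T x 0); [lra|].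
  pose proof (sin_gt_0 x ltac:(lra) ltac:(lra)); pose proof (sin_lt_x x ltac:(lra)).
  apply Rlt_div_r; lra.
Qed.

Lemma x_over_tan_open (x : R) : 0 < x < PI / 2 -> x_over_tan x = x * cos x / sin x.
Proof.
  intros Hx; unfold x_over_tan.
  destruct (Req_EM_T x 0), (Req_EM_T x (PI / 2)), (Req_EM_T x (- (PI / 2))); try lra.
  pose proof (sin_gt_0 x ltac:(lra) ltac:(lra)); pose proof (cos_gt_0 x ltac:(lra) ltac:(lra)).
  unfold tan; field; lra.
Qed.

Lemma x_over_tan_pos (x : R) : 0 < x < PI / 2 -> 0 < x_over_tan x.
Proof.
  intros Hx; rewrite x_over_tan_open by easy.
  pose proof (sin_gt_0 x ltac:(lra) ltac:(lra)); pose proof (cos_gt_0 x ltac:(lra) ltac:(lra)).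
  apply Rdiv_lt_0_compat; nra.
Qed.

Lemma ineq_i_strict (x : R) : 0 < x < PI / 2 ->
  (alpha - 1) * x_over_sin x + x_over_tan x < alpha.
Proof.
  intros Hx; rewrite x_over_tan_open by easy.
  unfold x_over_sin; destruct (Req_EM_T x 0); [lra|].
  pose proof (sin_gt_0 x ltac:(lra) ltac:(lra)).
  pose proof (ineq_i_polynomial_form x Hx).
  replace ((alpha - 1) * (x / sin x) + x * cos x / sin x)
    with (((alpha - 1) * x + x * cos x) / sin x) by (field; lra).
  apply Rlt_div_l; lra.
Qed.

(** The mean value point [c] lies strictly above [1], so the power has mean slope
    [p * Rpower c (p - 1) > p], more than the slope [p - 1] of the linear term. *)
Lemma Rpower_sub_linear_incr (p u v : R) : 1 < p -> 1 <= u -> u < v ->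
  Rpower u p - (p - 1) * u < Rpower v p - (p - 1) * v.
Proof.
  intros Hp Hu Huv.
  destruct (MVT_cor2 (fun t => Rpower t p) (fun t => p * Rpower t (p - 1)) u v Huv)
    as [c [Hc Hucv]].
  - intros t Ht; apply derivable_pt_lim_power; lra.
  - assert (1 < Rpower c (p - 1)).
    { pose proof (Rpower_lt c 0 (p - 1) ltac:(lra) ltac:(lra)) as H1.
      rewrite Rpower_O in H1; lra. }
    assert (p * 1 * (v - u) < p * Rpower c (p - 1) * (v - u)).
    { apply Rmult_lt_compat_r; [lra|]; apply Rmult_lt_compat_l; lra. }
    simpl in Hc; lra.
Qed.

Lemma ineq_ii_nonneg (x : R) : 0 <= x < PI / 2 ->
  Rpower (x_over_sin x) alpha + x_over_tan x < Rpower (PI / 2) alpha.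
Proof.
  intros Hx.
  pose proof alpha_sub_1_pos; pose proof alpha_at_PI2; pose proof PI_gt_2.
  assert (Hi : (alpha - 1) * x_over_sin x + x_over_tan x <= alpha /\
               1 <= x_over_sin x /\ x_over_sin x < PI / 2).
  { destruct (Req_dec x 0) as [-> | Hx0].
    - rewrite x_over_sin_0, x_over_tan_0; lra.
    - pose proof (ineq_i_strict x ltac:(lra)).
      pose proof (x_over_sin_gt_1 x ltac:(lra)).
      pose proof (x_over_tan_pos x ltac:(lra)).
      repeat split; try lra.
      (* The bound [x_over_sin x < PI / 2] also follows from (i): as [x_over_tan x > 0], [(alpha -
         1) * x_over_sin x < alpha = (alpha - 1) * (PI / 2)]. *)
      apply Rmult_lt_reg_l with (alpha - 1); lra. }
  destruct Hi as [Hi [Hu Hv]].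
  (* At the upper end [PI / 2] the linear term equals [alpha], cancelling the constant contributed
     by (i). *)
  pose proof (Rpower_sub_linear_incr alpha _ _ ltac:(lra) Hu Hv); lra.
Qed.

Lemma even_from_nonneg (P : R -> Prop) :
  (forall x, 0 <= x -> P x) -> (forall x, P x -> P (- x)) -> forall x, P x.
Proof.
  intros Hp He x; destruct (Rle_dec 0 x); [auto|].
  rewrite <- (Ropp_involutive x); apply He, Hp; lra.
Qed.

Lemma Rpower_le_inv (a p q : R) : 1 < a -> Rpower a p <= Rpower a q -> p <= q.
Proof.
  intros Ha H; apply Rnot_lt_le; intros Hlt.
  pose proof (Rpower_lt a q p Ha Hlt); lra.
Qed.

Theorem theorem1p12 :
  (* inequality (i), its equality cases, and optimality of alpha *)
  (forall x : R, - (PI / 2) <= x <= PI / 2 ->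
     (alpha - 1) * x_over_sin x + x_over_tan x <= alpha) /\
  (forall x : R, - (PI / 2) <= x <= PI / 2 ->
     ((alpha - 1) * x_over_sin x + x_over_tan x = alpha <->
      x = - (PI / 2) \/ x = 0 \/ x = PI / 2)) /\
  (forall beta : R,
     (forall x : R, - (PI / 2) <= x <= PI / 2 ->
        (beta - 1) * x_over_sin x + x_over_tan x <= beta) ->
     beta <= alpha) /\
  (* inequality (ii), its equality cases, and optimality of alpha as the
     exponent on the left and as the exponent on the right *)
  (forall x : R, - (PI / 2) < x < PI / 2 ->
     Rpower (x_over_sin x) alpha + x_over_tan x < Rpower (PI / 2) alpha) /\
  (forall x : R, x = - (PI / 2) \/ x = PI / 2 ->
     Rpower (x_over_sin x) alpha + x_over_tan x = Rpower (PI / 2) alpha) /\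
  (forall beta : R,
     (forall x : R, - (PI / 2) <= x <= PI / 2 ->
        Rpower (x_over_sin x) beta + x_over_tan x <= Rpower (PI / 2) alpha) ->
     beta <= alpha) /\
  (forall beta : R,
     (forall x : R, - (PI / 2) <= x <= PI / 2 ->
        Rpower (x_over_sin x) alpha + x_over_tan x <= Rpower (PI / 2) beta) ->
     alpha <= beta).
Proof.
  pose proof PI_gt_2; pose proof alpha_sub_1_pos; pose proof alpha_at_PI2.
  assert (Hi : forall x, - (PI / 2) <= x <= PI / 2 ->
     (alpha - 1) * x_over_sin x + x_over_tan x <= alpha /\
     ((alpha - 1) * x_over_sin x + x_over_tan x = alpha <->
      x = - (PI / 2) \/ x = 0 \/ x = PI / 2)).
  (* The range hypothesis is kept inside the predicate; the interval is symmetric, so it passes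
     between [x] and [- x]. *)
  { apply (even_from_nonneg (fun x => - (PI / 2) <= x <= PI / 2 -> _)).
    - intros x Hx0 Hx.
      destruct (Req_dec x 0) as [-> | Hx1].
      { rewrite x_over_sin_0, x_over_tan_0; repeat split; lra. }
      destruct (Req_dec x (PI / 2)) as [-> | Hx2].
      { rewrite x_over_sin_PI2, x_over_tan_PI2; repeat split; lra. }
      pose proof (ineq_i_strict x ltac:(lra)); repeat split; lra.
    - intros x IH Hx; rewrite x_over_sin_even, x_over_tan_even.
      destruct (IH ltac:(lra)) as [Hle Heq]; repeat split; [exact Hle | |].
      + intros E; apply Heq in E; lra.
      + intros E; apply Heq; lra. }
  split; [intros x Hx; apply Hi, Hx|].
  split; [intros x Hx; apply Hi, Hx|].
  split.
  { intros beta Hb; specialize (Hb (PI / 2) ltac:(lra)).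
    rewrite x_over_sin_PI2, x_over_tan_PI2 in Hb.
    unfold alpha; apply Rle_div_r; lra. }
  split.
  { apply (even_from_nonneg (fun x => - (PI / 2) < x < PI / 2 -> _)).
    - intros x Hx0 Hx; apply ineq_ii_nonneg; lra.
    - intros x IH Hx; rewrite x_over_sin_even, x_over_tan_even; apply IH; lra. }
  split.
  { intros x [-> | ->]; rewrite ?x_over_sin_even, ?x_over_tan_even,
      x_over_sin_PI2, x_over_tan_PI2; ring. }
  (* At [PI / 2] both hypotheses reduce to comparing two powers of the base [PI / 2 > 1]. *)
  split; intros beta Hb; specialize (Hb (PI / 2) ltac:(lra));
    rewrite x_over_sin_PI2, x_over_tan_PI2, Rplus_0_r in Hb;
    apply Rpower_le_inv with (PI / 2); lra.
Qed.
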